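(* Let $R$ be a rational function (with real coefficients) defined on all of $\mathbb{R}$, with $R''(x)\ge 0$ for all $x\in\mathbb{R}$. Then $I_R(P)=2$ for any point $P=(s,t)$ below the graph of $R$ (i.e. with $t<R(s)$).
   Context: For a differentiable function $f$ on $\mathbb{R}$ and a point $P$ not on the graph of $f$, the illumination index $I_f(P)$ is the number of distinct lines that are tangent to the graph of $f$ (i.e. lines $y=f(c)+f'(c)(x-c)$ for some $c\in\mathbb{R}$) and pass through $P$; a line tangent at several points is counted once. The value $\infty$ is allowed in general.
   Formalization: The rational function R is additionally assumed not to be affine: for R(x) = ax + b one has R'' = 0 ≥ 0, but the only tangent line is the graph itself, so I_R(P) = 0 for every point P below the graph. *)

(* Defs.v *)
From mathcomp Require Import all_boot all_order all_algebra.
From mathcomp Require Import all_classical all_reals all_analysis.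

Set Implicit Arguments.
Unset Strict Implicit.
Unset Printing Implicit Defensive.

Import Order.TTheory GRing.Theory Num.Theory numFieldNormedType.Exports.

Local Open Scope classical_set_scope.
Local Open Scope ring_scope.

(* [p] and [q] need not be coprime, but a rational function without real poles
   always has a representation whose denominator has no real root (its reduced
   form), so nothing is lost by requiring this of [q]. *)
Definition rational_on_line (R : realType) (f : R -> R) : Prop :=
  exists p q : {poly R},
    (forall x : R, q.[x] != 0) /\ (forall x : R, f x = p.[x] / q.[x]).

(* An affine graph is its own unique tangent line, so its illumination index is
   0 at every point off it, although its second derivative is nonnegative. *)
Definition affine_fun (R : realType) (f : R -> R) : Prop :=
  exists a b : R, forall x : R, f x = a * x + b.

Definition tangent_line (R : realType) (f : R -> R) (c : R) : set (R * R) :=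
  [set Q : R * R | Q.2 = f c + ((f^`())%classic c : R) * (Q.1 - c)].

(* Lines are sets of points, so a line tangent at several points is a single
   element of this set. *)
Definition tangent_lines_through (R : realType) (f : R -> R) (P : R * R) :
    set (set (R * R)) :=
  [set L | (exists c : R, L = tangent_line f c) /\ L P].

(* [counting] is the number of elements of a finite set, and [+oo] on infinite
   sets.  The index is meant for differentiable [f] and [P] off its graph. *)
Definition illumination_index (R : realType) (f : R -> R) (P : R * R) : \bar R :=
  counting (tangent_lines_through f P).

(* Main.v *)
Require Import Defs.
From mathcomp Require Import all_boot all_order all_algebra.
From mathcomp Require Import all_classical all_reals all_analysis.
From mathcomp Require Import finmap zify ring lra.

Import Order.TTheory GRing.Theory Num.Theory numFieldNormedType.Exports.

(** A nonnegative second derivative makes the tangents supporting lines: with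
m = f', one has f x + m x * (y - x) <= f y for all x and y
([tangent_line_below]). Everything else uses only this inequality, the
continuity of m and the growth of rational functions.

Existence. The tangent at c passes over s at height
g c = f c + m c * (s - c). At c = s this is f s > t, and the supporting
inequality at s + 1 gives g c <= f (s + 1) - m c. So as soon as m takes
arbitrarily large values to the right of s, the intermediate value theorem
yields a tangent through (s, t) with c > s ([tangent_on_the_right]); the
reflection x |-> - x yields one with c < s.

Unbounded slopes are where rationality enters ([slopes_unbounded_right]). If m
were bounded above to the right of s, then f = p / q would be squeezed between
two lines there, so deg p <= deg q + 1 and f = a x + b + r / q with
deg r < deg q. The bound |r / q| < 1 then holds near both infinities: what
happens on the right controls the left as well. A supporting line that stays
below a x + b + 1 at both ends must have slope a, so all tangents have slope a
and f is affine.

Counting. Two tangents through (s, t) touching on the same side of s have the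
same slope, hence coincide ([tangents_same_side]); two tangents touching on
opposite sides have slopes separated by m s ([tangents_opposite_sides]); and
the tangent at s itself misses (s, t). *)

Local Open Scope classical_set_scope.
Local Open Scope ring_scope.

(** * Growth of polynomials *)

(** The extra factor |x| on the left stands for |p x| <= C |x|^(n - 1) without
subtracting from n, so that the case n = 0 needs no separate treatment. *)
Lemma normr_horner_le (R : realFieldType) (p : {poly R}) (n : nat) (x : R) :
  (size p <= n)%N -> 1 <= `|x| ->
  `|x| * `|p.[x]| <= (\sum_(i < n) `|p`_i|) * `|x| ^+ n.
Proof.
move=> pn x1; rewrite (horner_coef_wide x pn) mulr_suml.
apply: (@le_trans _ _ (`|x| * \sum_(i < n) `|p`_i * x ^+ i|)).
  by rewrite ler_wpM2l// ler_norm_sum.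
rewrite mulr_sumr ler_sum// => i _.
rewrite normrM normrX mulrCA -exprS ler_wpM2l//.
by rewrite ler_weXn2l.
Qed.

(** The leading monomial of q eventually dominates both its own lower terms and
all of r. No sign condition on x: the bound holds near both infinities. *)
Lemma size_lt_horner_lt (R : realFieldType) (r q : {poly R}) :
  (size r < size q)%N ->
  exists N : R, forall x, N <= `|x| -> `|r.[x]| < `|q.[x]|.
Proof.
move=> rq; have q0 : q != 0 by rewrite -size_poly_gt0 (leq_ltn_trans _ rq).
have lq0 : 0 < `|lead_coef q| by rewrite normr_gt0 lead_coef_eq0.
set n := (size q).-1.
have sq : size q = n.+1 by rewrite prednK// size_poly_gt0.
pose q' := q - lead_coef q *: 'X^n.
have q'n : (size q' <= n)%N.
  apply/leq_sizeP => j; rewrite leq_eqVlt => /predU1P[<-|nj].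
    by rewrite coefB coefZ coefXn eqxx mulr1 subrr.
  by rewrite coefB coefZ coefXn gtn_eqF// mulr0 subr0 nth_default// sq.
have rn : (size r <= n)%N by rewrite -ltnS -sq.
set A := \sum_(i < n) `|q'`_i|; set B := \sum_(i < n) `|r`_i|.
(* |q x| - |r x| is at least |x|^(n-1) (|lead_coef q| |x| - A - B). *)
exists (1 + (A + B + 1) / `|lead_coef q|) => x Nx.
have A0 : 0 <= A by apply: sumr_ge0.
have B0 : 0 <= B by apply: sumr_ge0.
have x1 : 1 <= `|x|.
  by apply: le_trans Nx; rewrite lerDl divr_ge0// ?addr_ge0.
have hq' := normr_horner_le _ _ _ _ q'n x1; rewrite -/A in hq'.
have hr := normr_horner_le _ _ _ _ rn x1; rewrite -/B in hr.
have x0 : 0 < `|x| by apply: lt_le_trans x1.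
have lx : A + B + 1 <= `|lead_coef q| * `|x|.
  rewrite mulrC -ler_pdivrMr//; apply: le_trans Nx; by rewrite lerDr.
have xn0 : 0 < `|x| ^+ n by rewrite exprn_gt0.
have qx : q.[x] = lead_coef q * x ^+ n + q'.[x].
  by rewrite /q' !hornerE/=; ring.
have hq : `|lead_coef q| * `|x| ^+ n <= `|q.[x]| + `|q'.[x]|.
  rewrite -normrX -normrM.
  have -> : lead_coef q * x ^+ n = q.[x] - q'.[x] by rewrite qx; ring.
  exact: ler_normB.
rewrite -(ltr_pM2l x0).
have := ler_wpM2l (ltW x0) hq.
have := ler_wpM2l (ltW xn0) lx.
move: (`|x| ^+ n) (`|q.[x]|) (`|q'.[x]|) (`|r.[x]|) (`|lead_coef q|) xn0 hr hq'
  => X Q Q' S L xn0 hr hq'.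
nra.
Qed.

(** The hypothesis covers both ends of the line, which excludes either sign of
k. *)
Lemma linear_bounded_eq0 (R : realFieldType) (N k K : R) :
  (forall y, N <= `|y| -> k * y <= K) -> k = 0.
Proof.
move=> kK; apply/eqP; apply/negPn/negP => k0.
have nk0 : 0 < `|k| by rewrite normr_gt0.
(* z exceeds K, and is large enough for z / k to be in the allowed range. *)
pose z := `|K| + 1 + `|N| * `|k|.
have z0 : 0 < z by rewrite /z; have := normr_ge0 K; have := normr_ge0 N; nra.
have kz : k * (z / k) = z by field.
have zk : N <= `|z / k|.
  rewrite normrM normfV (gtr0_norm z0) ler_pdivlMr//.
  have := ler_norm N; have := normr_ge0 K; have := normr_ge0 N.
  by rewrite /z; nra.
have := kK _ zk; rewrite kz /z; have := ler_norm K; have := normr_ge0 N.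
nra.
Qed.

(** * Tangents of convex rational functions *)

Section rational_derivative.
Variable R : realType.
Implicit Types f : R -> R.

Lemma rational_derivable f x : rational_on_line f -> derivable f x 1.
Proof.
move=> [p [q [q0 fpq]]].
rewrite (_ : f = (horner p) * (fun y => (q.[y])^-1)); last exact/funext.
apply: derivableM; first exact: derivable_horner.
by apply: derivableV => //; exact: derivable_horner.
Qed.

Lemma rational_continuous f : rational_on_line f -> continuous f.
Proof.
move=> rf x; apply: differentiable_continuous.
exact/derivable1_diffP/rational_derivable.
Qed.

(** Stability under differentiation makes f' differentiable as well, hence
continuous and monotone under a sign condition on f''. *)
Lemma rational_derive1 f : rational_on_line f -> rational_on_line f^`()%classic.
Proof.
move=> [p [q [q0 fpq]]]; exists (p^`() * q - p * q^`()), (q ^+ 2); split=> x.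
  by rewrite horner_exp expf_neq0.
rewrite (_ : f = (horner p) * (fun y => (q.[y])^-1)); last exact/funext.
have dp : derivable (horner p) x 1 by exact: derivable_horner.
have dq : derivable (horner q) x 1 by exact: derivable_horner.
have dqV : derivable (fun y => (q.[y])^-1) x 1.
  by apply: derivableV => //; exact: q0.
rewrite derive1E deriveM//.
rewrite deriveV// -!derive1E -!derivE.
rewrite /GRing.scale/= !hornerE/=; field.
exact: q0.
Qed.

(** By the mean value theorem the chord from x to y has slope f' c for some c
between them; as f' is nondecreasing, this is at least f' x if x < y and at
most f' x if y < x. *)
Lemma tangent_line_below f : rational_on_line f ->
  (forall x, 0 <= (f^`(2))%classic x) ->
  forall x y, f x + f^`()%classic x * (y - x) <= f y.
Proof.
move=> rf f2 x y; have rf' := rational_derive1 f rf.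
have mono u v : u <= v -> f^`()%classic u <= f^`()%classic v.
  move=> uv; apply: (@ger0_derive1_ndecr _ _ u v) => //.
  - by move=> z _; exact: rational_derivable.
  - by move=> z _; exact: f2.
  - exact/continuous_subspaceT/rational_continuous.
have mvt u v : u < v -> exists2 c, c \in `]u, v[%R &
    f v - f u = f^`()%classic c * (v - u).
  move=> uv; apply: MVT => //; last exact/continuous_subspaceT/rational_continuous.
  by move=> z _; rewrite derive1E; apply/derivableP/rational_derivable.
have [xy|yx|->] := ltgtP x y; last by rewrite subrr mulr0 addr0.
- have [c] := mvt _ _ xy; rewrite in_itv/= => /andP[xc _] E.
  by have := mono _ _ (ltW xc); nra.
- have [c] := mvt _ _ yx; rewrite in_itv/= => /andP[_ cx] E.
  by have := mono _ _ (ltW cx); nra.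
Qed.

End rational_derivative.

(** * Functions with a supporting line of slope m x at each x *)

Section supporting_lines.
Variables (R : realType) (f m : R -> R).
Hypothesis f_supp : forall x y, f x + m x * (y - x) <= f y.

(** A supporting line below a y + b near both infinities has slope a. Once all
slopes are a, the supporting inequalities between 0 and x, taken both ways,
determine f x. *)
Lemma affine_near_infinity (a b N : R) :
  (forall y, N <= `|y| -> f y <= a * y + b) -> affine_fun f.
Proof.
move=> fab; have ma x : m x = a.
  apply/eqP; rewrite -subr_eq0; apply/eqP.
  apply: (@linear_bounded_eq0 _ N _ (b - f x + m x * x)) => y Ny.
  by have := f_supp x y; have := fab y Ny; nra.
exists a, (f 0) => x.
have := f_supp x 0; have := f_supp 0 x; rewrite !ma.
by move=> h1 h2; apply/eqP; rewrite eq_le; apply/andP; split; lra.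
Qed.

(** Bounded slopes force at most linear growth on the right half-line, which a
rational function can only achieve with an oblique asymptote, common to both
ends; convexity then leaves no room above it. *)
Lemma slopes_unbounded_right : rational_on_line f -> ~ affine_fun f ->
  forall s M, exists2 c, s < c & M <= m c.
Proof.
move=> [p [q [q0 fpq]]] naff s M; apply: contrapT => noc.
apply: naff.
have mM c : s < c -> m c < M.
  by move=> sc; rewrite ltNge; apply/negP => Mm; apply: noc; exists c.
have qN0 : q != 0 by apply/eqP => q00; have := q0 0; rewrite q00 horner0 eqxx.
have pq : (size p <= (size q).+1)%N.
  rewrite leqNgt; apply/negP => qp.
  (* L is a linear majorant of |f| to the right of s: the upper bound comes from
     the slopes below M, the lower one from the tangent at s. *)
  pose K := `|M| + `|m s|; pose L : {poly R} := K *: 'X + (`|f s| - K * s)%:P.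
  have sL : (size L <= 2)%N.
    rewrite (leq_trans (size_polyD _ _))// geq_max.
    rewrite (leq_trans (size_scale_leq _ _)) ?size_polyX//=.
    by rewrite (leq_trans (size_polyC_leq1 _)).
  have /size_lt_horner_lt[N HN] : (size (L * q)%R < size p)%N.
    apply: leq_ltn_trans qp; apply: leq_trans (size_polyMleq L q) _.
    by move: sL; case: (size L) => [|[|[|]]]//= _; rewrite ?add0n ?leq_pred//; lia.
  pose x := `|N| + `|s| + 1.
  have [sx Nx] : s < x /\ N <= `|x|.
    have := ler_norm N; have := ler_norm s; have := normr_ge0 N.
    have := normr_ge0 s; rewrite /x => ? ? ? ?; split; first lra.
    by apply: le_trans (ler_norm _); lra.
  have := HN x Nx; rewrite hornerM normrM -ltr_pdivlMr ?normr_gt0//.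
  rewrite -normf_div -fpq; apply/negP; rewrite -leNgt.
  apply: le_trans (ler_norm _); rewrite /L !hornerE/= /K.
  have := f_supp x s; have := f_supp s x; have := mM x sx.
  have := ler_norm M; have := ler_norm (f s); have := ler_norm (- f s).
  have := ler_norm (- m s); have := normr_ge0 M; have := normr_ge0 (m s).
  rewrite !normrN ler_norml => *; apply/andP; split; nra.
(* The quotient of p by q is the asymptote; the remainder contributes less
   than 1 to f far away. *)
have [N HN] := size_lt_horner_lt _ _ _ (ltn_modpN0 p qN0).
have sd : (size (p %/ q)%R <= 2)%N.
  rewrite size_divp// leq_subLR; move: pq (qN0); rewrite -size_poly_gt0.
  by case: (size q) => // n; rewrite /= addn2.
apply: (@affine_near_infinity (p %/ q)`_1 ((p %/ q)`_0 + 1) N) => y Ny.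
have -> : f y = (p %/ q).[y] + (p %% q).[y] / q.[y].
  rewrite fpq {1}(divp_eq p q) !hornerE/=; field; exact: q0.
rewrite (horner_coef_wide _ sd) big_ord_recr big_ord1/= expr0 expr1 mulr1.
have : (p %% q).[y] / q.[y] <= 1.
  apply: le_trans (ler_norm _) _; rewrite normf_div.
  by rewrite ler_pdivrMr ?normr_gt0// mul1r ltW// HN.
lra.
Qed.

Lemma tangent_on_the_right (s t : R) : rational_on_line f -> ~ affine_fun f ->
  continuous m -> t < f s -> exists2 c, s < c & f c + m c * (s - c) = t.
Proof.
move=> rf naff mc ts.
(* By the supporting inequality at s + 1, a slope of this size pushes the
   tangent down to height t or less at s. *)
have [c sc hc] := slopes_unbounded_right rf naff s (f (s + 1) - t).
pose g x := f x + m x * (s - x).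
have gc : continuous g.
  move=> x; apply: cvgD.
    exact: rational_continuous.
  by apply: cvgM; [exact: mc|apply: cvgB; [exact: cvg_cst|exact: cvg_id]].
have gs : g s = f s by rewrite /g subrr mulr0 addr0.
have gct : g c <= t by rewrite /g; have := f_supp c (s + 1); nra.
have [d] : exists2 d, d \in `[s, c]%R & g d = t.
  apply: IVT; [exact: ltW|exact: continuous_subspaceT|].
  by rewrite gs min_r ?max_l ?gct/= ?ltW// (le_lt_trans gct ts).
rewrite in_itv/= => /andP[sd _] gd; exists d => //.
rewrite lt_neqAle sd andbT; apply/eqP => sd'.
by move: ts; rewrite -gs sd' gd ltxx.
Qed.

(** Each tangent stays below f at the other contact point; if both points lie
on the same side of s, the two comparisons of slopes go opposite ways. *)
Lemma tangents_same_side (s t c d : R) : 0 < (c - s) * (d - s) ->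
  f c + m c * (s - c) = t -> f d + m d * (s - d) = t -> m c = m d.
Proof.
move=> cd hc hd.
have hcd : 0 <= (m d - m c) * (d - s) by have := f_supp c d; nra.
have hdc : 0 <= (m c - m d) * (c - s) by have := f_supp d c; nra.
(* The product of the two is - (m c - m d) ^ 2 times a positive number. *)
apply/eqP; rewrite -subr_eq0 -sqrf_eq0 eq_le sqr_ge0 andbT.
rewrite -(pmulr_lle0 _ cd) -oppr_ge0.
by have := mulr_ge0 hcd hdc; congr (0 <= _); ring.
Qed.

(** The tangent at s lies above (s, t) but below f at both contact points, so
its slope separates the other two strictly. *)
Lemma tangents_opposite_sides (s t c d : R) : t < f s -> c < s -> s < d ->
  f c + m c * (s - c) = t -> f d + m d * (s - d) = t -> m c < m d.
Proof.
move=> ts cs sd hc hd; have := f_supp s c; have := f_supp s d => sc sd'.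
by apply: (@lt_trans _ _ (m s)); nra.
Qed.

End supporting_lines.

(** * Reflection *)

Lemma rational_reflect (R : realType) (f : R -> R) :
  rational_on_line f -> rational_on_line (fun x => f (- x)).
Proof.
move=> [p [q [q0 fpq]]]; exists (p \Po - 'X), (q \Po - 'X).
by split=> x; rewrite !horner_comp !hornerE.
Qed.

Lemma affine_reflect (R : realType) (f : R -> R) :
  affine_fun (fun x => f (- x)) -> affine_fun f.
Proof.
move=> [a [b fab]]; exists (- a), b => x.
by rewrite -[x in f x]opprK fab; ring.
Qed.

Lemma tangent_on_the_left (R : realType) (f m : R -> R) (s t : R) :
  (forall x y, f x + m x * (y - x) <= f y) ->
  rational_on_line f -> ~ affine_fun f -> continuous m -> t < f s ->
  exists2 c, c < s & f c + m c * (s - c) = t.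
Proof.
move=> f_supp rf naff mc ts.
have [||||c sc <-] := @tangent_on_the_right R (fun x => f (- x))
    (fun x => - m (- x)) _ (- s) t (rational_reflect _ f rf).
- by move=> x y; have := f_supp (- x) (- y); nra.
- by move/affine_reflect.
- move=> x; apply: cvgN.
  by apply: (@continuous_comp _ _ _ -%R m); [exact: oppr_continuous|exact: mc].
- by rewrite opprK.
by exists (- c); [lra|ring].
Qed.

(** * Counting tangent lines *)

(** Tangents are compared as sets of points, but through a common point they
are determined by their slopes. *)
Lemma tangent_line_eq (R : realType) (f : R -> R) (s t c d : R) :
  tangent_line f c (s, t) -> tangent_line f d (s, t) ->
  tangent_line f c = tangent_line f d <-> f^`()%classic c = f^`()%classic d.
Proof.
rewrite /tangent_line/= => hc hd; split=> [E|E].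
  (* A second common point of the two lines. *)
  have : tangent_line f d (s + 1, f c + f^`()%classic c * (s + 1 - c)).
    by rewrite -[tangent_line f d]E.
  rewrite /tangent_line/=; lra.
apply/seteqP; split=> -[x y]/=; rewrite E in hc *; lra.
Qed.

Lemma counting_pair (R : realType) (T : choiceType) (a b : T) : a != b ->
  counting [set a; b] = 2%:E :> \bar R.
Proof.
move=> ab; rewrite /counting asboolT ?fset_setU1 ?fset_set1//.
by rewrite cardfs2 ab.
Qed.

Theorem proposition2p1 (R : realType) (f : R -> R)
    (f_rational : rational_on_line f)
    (f_not_affine : ~ affine_fun f)
    (f_convex : forall x : R, 0 <= (f^`(2))%classic x)
    (s t : R) (P_below : t < f s) :
  illumination_index f (s, t) = 2%:E.
Proof.
pose m := f^`()%classic.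
have f_supp : forall x y, f x + m x * (y - x) <= f y.
  exact: tangent_line_below.
have m_cont : continuous m.
  exact/rational_continuous/rational_derive1.
have [d sd hd] := tangent_on_the_right _ f m f_supp s t f_rational
  f_not_affine m_cont P_below.
have [c cs hc] := tangent_on_the_left _ f m s t f_supp f_rational
  f_not_affine m_cont P_below.
have mcd := tangents_opposite_sides _ f m f_supp s t c d P_below cs sd hc hd.
rewrite /illumination_index.
suff -> : tangent_lines_through f (s, t) =
    [set tangent_line f c; tangent_line f d].
  apply: counting_pair; apply/eqP.
  move/(tangent_line_eq _ f s t c d (esym hc) (esym hd)) => E.
  by move: mcd; rewrite /m E ltxx.
apply/seteqP; split=> [L [[e ->] he]|L [|] ->].
- have he' : f e + m e * (s - e) = t by exact: esym he.
  have [es|se|es] := ltgtP e s.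
  + left; apply/(tangent_line_eq _ f s t e c he (esym hc)).
    by apply: (tangents_same_side _ f m f_supp s t) => //; nra.
  + right; apply/(tangent_line_eq _ f s t e d he (esym hd)).
    by apply: (tangents_same_side _ f m f_supp s t) => //; nra.
  + by move: he' P_below; rewrite es subrr mulr0 addr0 => ->; rewrite ltxx.
- by split; [exists c|exact: esym hc].
- by split; [exists d|exact: esym hd].
Qed.
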